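(* Let $H$ be an infinite-dimensional Hilbert space. Then the set of $2$-isometries $\{T\in\mathcal{B}(H) : T\text{ is a }2\text{-isometry}\}$ is not closed in the strong operator topology on $\mathcal{B}(H)$.
   Context: $\mathcal{B}(H)$ denotes the bounded linear operators on $H$. An operator $T\in\mathcal{B}(H)$ is called a $2$-isometry if $1-2T^*T+{T^*}^2T^2=0$, where $1$ is the identity operator. The strong operator topology (SOT) on $\mathcal{B}(H)$ is the topology of pointwise norm convergence of nets: $T_\alpha\to T$ iff $\|T_\alpha x-Tx\|\to 0$ for every $x\in H$. Closedness is topological closedness (under nets, not only sequences). *)

(* Defs.v *)
From HB Require Import structures.
From mathcomp Require Import all_boot all_order all_algebra.
From mathcomp Require Import complex.
From mathcomp Require Import boolp classical_sets reals topology normedtype.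

Set Implicit Arguments.
Unset Strict Implicit.
Unset Printing Implicit Defensive.

Import Order.TTheory GRing.Theory Num.Theory.
Import numFieldNormedType.Exports.

Local Open Scope classical_set_scope.
Local Open Scope ring_scope.

(* The scalars of a Hilbert space: the real or the complex numbers, together
   with their conjugation (trivial in the real case). *)
Variant real_or_complex : forall K : numFieldType, {rmorphism K -> K} -> Prop :=
| RealScalars (R : realType) : @real_or_complex R idfun
| ComplexScalars (R : realType) : @real_or_complex R[i] Num.conj.

(* Together with the completeness of H, this makes (H, dot) a Hilbert space.
   A form of type {dot H for theta} is linear in its first argument,
   conjugate-linear in the second one, hermitian and positive definite. *)
Definition norm_induced_by (K : numFieldType) (theta : {rmorphism K -> K})
    (H : normedModType K) (dot : {dot H for theta}) : Prop :=
  forall x : H, `|x| ^+ 2 = dot x x.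

Definition infinite_dimensional (K : numFieldType) (V : lmodType K) : Prop :=
  ~ exists (n : nat) (e : 'I_n -> V),
      forall x, exists c : 'I_n -> K, x = \sum_(i < n) c i *: e i.

Record bounded_operator (K : numFieldType) (H : normedModType K) : Type :=
  BoundedOperator {
    operator_fun :> {linear H -> H} ;
    operator_bounded : exists M : K, forall x, `|operator_fun x| <= M * `|x|
  }.

HB.instance Definition _ (K : numFieldType) (H : normedModType K) :=
  gen_eqMixin (bounded_operator H).
HB.instance Definition _ (K : numFieldType) (H : normedModType K) :=
  gen_choiceMixin (bounded_operator H).

Lemma zero_operator_bounded (K : numFieldType) (H : normedModType K) :
  exists M : K, forall x : H, `|(\0 : {linear H -> H}) x| <= M * `|x|.
Proof. by exists 0 => x; rewrite mul0r normr0. Qed.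

Definition zero_operator (K : numFieldType) (H : normedModType K) :
  bounded_operator H := BoundedOperator (zero_operator_bounded H).

Definition is_adjoint (K : numFieldType) (theta : {rmorphism K -> K})
    (H : normedModType K) (dot : {dot H for theta})
    (T S : bounded_operator H) : Prop :=
  forall x y : H, dot (T x) y = dot x (S y).

(* On a Hilbert space every bounded operator has exactly one adjoint, so the
   default value zero_operator is irrelevant there. *)
Definition adjoint (K : numFieldType) (theta : {rmorphism K -> K})
    (H : normedModType K) (dot : {dot H for theta})
    (T : bounded_operator H) : bounded_operator H :=
  xget (zero_operator H) [set S | is_adjoint dot T S].

Definition two_isometry (K : numFieldType) (theta : {rmorphism K -> K})
    (H : normedModType K) (dot : {dot H for theta})
    (T : bounded_operator H) : Prop :=
  let T' := adjoint dot T in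
  forall x : H, x - 2%:R *: T' (T x) + T' (T' (T (T x))) = 0.

(* The bounded operators on H with the strong operator topology. *)
Definition SOT (K : numFieldType) (H : normedModType K) : Type :=
  initial_topology
    (fun T : bounded_operator H => (T : H -> H) : {ptws H -> H}).

HB.instance Definition _ (K : numFieldType) (H : normedModType K) :=
  Topological.on (SOT H).

Lemma cvg_SOT (K : numFieldType) (H : normedModType K)
    (F : set_system (SOT H)) (T : SOT H) : Filter F ->
  F --> T <-> forall x : H, (fun S : SOT H => S x) @ F --> T x.
Proof.
pose incl (S : SOT H) : {ptws H -> H} := (S : H -> H).
move=> FF; split=> [FT x|FT].
  have evx : continuous ((fun f : {ptws H -> H} => f x) \o incl).
    move=> S; apply: continuous_comp; first exact: initial_continuous.
    exact: (@proj_continuous H (fun=> H) x).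
  by move=> A /evx; exact: FT.
move=> A [B [[C Co <-] CT] BA].
have /(_ C (open_nbhs_nbhs (conj Co CT))) : incl @ F --> incl T.
  by apply/pointwise_cvgP => x; exact: FT.
by move=> FC; apply: (@filterS _ F FF _ _ BA).
Qed.

(* Main.v *)
Require Import Defs.
From HB Require Import structures.
From mathcomp Require Import all_boot all_order all_algebra.
From mathcomp Require Import complex.
From mathcomp Require Import boolp classical_sets reals topology normedtype.
From mathcomp Require Import sequences ring.

Local Open Scope classical_set_scope.
Local Open Scope ring_scope.

Import Order.TTheory GRing.Theory Num.Theory.
Import numFieldNormedType.Exports.

Set Implicit Arguments.
Unset Strict Implicit.
Unset Printing Implicit Defensive.

(** Fix a unit vector e.  The operator A x = x + (2/3) <x, e> e is not a
2-isometry: it is self-adjoint with eigenvalue 5/3 at e, and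
1 - 2 t^2 + t^4 = (1 - t^2)^2 does not vanish at t = 5/3.  However, every
strong neighbourhood of A contains a 2-isometry
([two_isometry_approximation], [closure_SOT]), so the set of 2-isometries is
not closed.

The 2-isometries close to A come from the following remark
([two_isometry_of_pair]).  If T^*T = 1 + k v v^* with T^*v = v, then
T^*(T^*T)T = T^*T + k v v^*, whence 1 - 2 T^*T + T^*^2 T^2 = 0.  The norm of
such operators can be arbitrarily large, which is why a net of them can converge
strongly to an operator that is not a 2-isometry: strong limits of sequences of
2-isometries are 2-isometries, because strongly convergent sequences are
bounded.

Let X be a finite set of vectors.  Since H is infinite-dimensional there is an
orthonormal sequence f, g_0, g_1, ... orthogonal to e and to X
([orthonormal_sequence]).  Let U be the isometry that shifts the g_n and fixes
their orthogonal complement ([unilateral_shift]).  For a small alpha > 0 and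
alpha^2 + beta^2 = 1, turn the pair (e, f) into

  v = alpha e + beta f  and  w = beta e - alpha f.

Let R be the reflection sending w to (3/5) w + (4/5) g_0 and fixing v, and let
T x = R (U x + s <x, v> g_0) with s = 4 beta / (3 alpha).  As R U is an isometry
whose range is orthogonal to R g_0, and as R and U fix v, this T satisfies the
remark with k = s^2.  A vector x of X is fixed by U, and its
inner products with v and w are alpha <x, e> and beta <x, e>; the choice of s
cancels the g_0 component of T x and leaves

  T x - A x = - (2/3) alpha <x, e> v,

which is as small as desired on X.

Adjoints are exhibited explicitly throughout, as pairs of functions S, S' with
<S x, y> = <x, S' y>: such functions are automatically linear, and S' inherits
the bounds of S. *)

(** * Inner products *)

(** A nonnegative series of complex numbers is a series of reals, so the complex
case also follows from the convergence of bounded monotone real sequences. *)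
Lemma nonneg_series_cauchy (K : numFieldType) (theta : {rmorphism K -> K})
    (u : nat -> K) (M : K) : real_or_complex theta ->
  (forall n, 0 <= u n) -> (forall n, series u n <= M) ->
  cauchy (series u @ \oo).
Proof.
move=> Ks; case: {K theta} Ks u M => [R|R] u M u0 uM.
  apply/cvg_cauchy; apply: nondecreasing_is_cvgn.
    exact: nondecreasing_series.
  by exists M => _ [n _ <-]; apply: uM.
pose r n := complex.Re (u n).
have uE n : u n = (r n)%:C%C.
  by move: (u0 n); rewrite /r; case: (u n) => a b; rewrite lecE /= => /andP[/eqP ->].
have sE m n : \sum_(m <= k < n) u k = (\sum_(m <= k < n) r k)%:C%C.
  by rewrite rmorph_sum; apply: eq_bigr => k _; rewrite uE.
have r0 n : 0 <= r n by rewrite -ler0c -uE.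
have : cauchy (series r @ \oo).
  apply/cvg_cauchy; apply: nondecreasing_is_cvgn.
    exact: nondecreasing_series.
  exists (complex.Re M) => _ [n _ <-].
  by have := uM n; rewrite /series/= sE lecE => /andP[].
move/cauchy_seriesP => rc; apply/cauchy_seriesP => e.
case: e => a b; rewrite ltcE /= => /andP[/eqP b0 a0]; rewrite b0.
have := rc a a0; apply: filterS => n; rewrite sE normc_def/=.
by rewrite expr0n addr0 sqrtr_sqr ltcR.
Qed.

Section InnerProduct.
Variables (K : numFieldType) (theta : {rmorphism K -> K}).
Variables (H : normedModType K) (dot : {dot H for theta}).
Hypothesis dotP : norm_induced_by dot.
Implicit Types (a : K) (x y z : H) (S : H -> H).

Local Notation "''[' u , v ]" := (dot u v).

Lemma dotC x y : '[x, y] = theta '[y, x].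
Proof. by rewrite hermC expr0 mul1r. Qed.

Lemma dotDl x y z : '[x + y, z] = '[x, z] + '[y, z].
Proof. exact: linearDl. Qed.

Lemma dotNl x y : '[- x, y] = - '[x, y].
Proof. exact: linearNl. Qed.

Lemma dotBl x y z : '[x - y, z] = '[x, z] - '[y, z].
Proof. exact: linearBl. Qed.

Lemma dotZl a x y : '[a *: x, y] = a * '[x, y].
Proof. exact: linearZl_LR. Qed.

Lemma dot0l x : '[0, x] = 0.
Proof. exact: linear0l. Qed.

Lemma dotDr x y z : '[x, y + z] = '[x, y] + '[x, z].
Proof. exact: linearDr. Qed.

Lemma dotNr x y : '[x, - y] = - '[x, y].
Proof. exact: linearNr. Qed.

Lemma dotBr x y z : '[x, y - z] = '[x, y] - '[x, z].
Proof. exact: linearBr. Qed.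

Lemma dotZr a x y : '[x, a *: y] = theta a * '[x, y].
Proof. by rewrite linearZr_LR. Qed.

Lemma dot0r x : '[x, 0] = 0.
Proof. exact: linear0r. Qed.

Lemma dot_suml (u : nat -> H) m n y :
  '[\sum_(m <= k < n) u k, y] = \sum_(m <= k < n) '[u k, y].
Proof.
by apply: (big_morph (fun x => '[x, y])) => [? ?|]; [exact: dotDl | exact: dot0l].
Qed.

Lemma dot_sumr (u : nat -> H) m n x :
  '[x, \sum_(m <= k < n) u k] = \sum_(m <= k < n) '[x, u k].
Proof.
by apply: (big_morph (dot x)) => [? ?|]; [exact: dotDr | exact: dot0r].
Qed.

Definition dotE := (dotDl, dotNl, dotZl, dotDr, dotNr, dotZr).

Lemma dot_eq0C x y : '[x, y] = 0 -> '[y, x] = 0.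
Proof. by move=> xy; rewrite dotC xy rmorph0. Qed.

Lemma eq_dotr x y : (forall z, '[z, x] = '[z, y]) -> x = y.
Proof.
move=> xy; apply/eqP; rewrite -subr_eq0 -normr_eq0 -sqrf_eq0 dotP.
by rewrite dotBr xy subrr.
Qed.

Lemma eq_dotl x y : (forall z, '[x, z] = '[y, z]) -> x = y.
Proof. by move=> xy; apply: eq_dotr => z; rewrite dotC xy -dotC. Qed.

Lemma dot_unit x : `|x| = 1 -> '[x, x] = 1.
Proof. by move=> x1; rewrite -dotP x1 expr1n. Qed.

Lemma norm_unit x : '[x, x] = 1 -> `|x| = 1.
Proof. by rewrite -dotP => /eqP; rewrite sqrp_eq1 // => /eqP. Qed.

(** The conjugation theta fixes the nonnegative scalars a because both
theta(a) a and a^2 are the squared norm of a x. *)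
Lemma theta_ge0 x a : `|x| = 1 -> 0 <= a -> theta a = a.
Proof.
move=> x1 a0; have [->|aN0] := eqVneq a 0; first exact: rmorph0.
apply: (mulfI aN0); rewrite -[RHS]expr2.
have := dotP (a *: x); rewrite normrZ x1 mulr1 ger0_norm // dotZl dotZr.
by rewrite dot_unit // mulr1 => ->.
Qed.

Lemma pythagoras x y : '[x, y] = 0 -> `|x + y| ^+ 2 = `|x| ^+ 2 + `|y| ^+ 2.
Proof.
by move=> xy; rewrite !dotP !dotE xy (dot_eq0C xy) addr0 add0r.
Qed.

(** The component of x along y is no longer than x. *)
Lemma cauchy_schwarz x y : `|'[x, y]| <= `|x| * `|y|.
Proof.
have [->|yN0] := eqVneq y 0; first by rewrite dot0r !normr0 mulr0.
have ny : 0 < `|y| by rewrite normr_gt0.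
have dy : '[y, y] != 0 by rewrite -dotP expf_neq0 // gt_eqF.
pose c := '[x, y] / '[y, y].
have cE : '[x, y] = c * `|y| ^+ 2 by rewrite dotP mulfVK.
rewrite cE normrM (ger0_norm (exprn_ge0 _ _)) // expr2 mulrA ler_pM2r // -normrZ.
rewrite -ler_sqr ?nnegrE // -[in leRHS](subrKC (c *: y) x) pythagoras ?lerDl ?exprn_ge0 //.
by apply: dot_eq0C; rewrite dotZr dotBl dotZl divfK // subrr mulr0.
Qed.

(** * Operators given with their adjoint *)

Definition adjoint_pair (S S' : H -> H) := forall x y, '[S x, y] = '[x, S' y].

Lemma adjoint_pairC S S' : adjoint_pair S S' -> adjoint_pair S' S.
Proof. by move=> SS' x y; rewrite dotC -SS' -dotC. Qed.

(** <S (a x + y), z> = <a x + y, S' z> is linear in its left argument. *)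
Lemma adjoint_pair_linear S S' : adjoint_pair S S' -> linear S.
Proof.
by move=> SS' a x y; apply: eq_dotl => z; rewrite !(dotE, SS').
Qed.

(** |S' x|^2 = <S (S' x), x> is at most M |S' x| |x|. *)
Lemma adjoint_pair_bounded S S' (M : K) : 0 <= M -> adjoint_pair S S' ->
  (forall x, `|S x| <= M * `|x|) -> forall x, `|S' x| <= M * `|x|.
Proof.
move=> M0 SS' SM x; have [->|S'x0] := eqVneq (S' x) 0.
  by rewrite normr0 mulr_ge0.
rewrite -(@ler_pM2l _ `|S' x|) ?normr_gt0 //.
rewrite -expr2 dotP -SS' -[leLHS]ger0_norm; last by rewrite SS' -dotP exprn_ge0.
apply: le_trans (cauchy_schwarz _ _) _.
by rewrite mulrA [_ * M]mulrC ler_wpM2r.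
Qed.

Lemma bounded_operatorE S S' (M : K) : adjoint_pair S S' ->
  (forall x, `|S x| <= M * `|x|) ->
  exists T : bounded_operator H, (T : H -> H) = S.
Proof.
move=> SS' SM.
pose L : {linear H -> H} :=
  HB.pack S (GRing.isLinear.Build K H H *:%R S (adjoint_pair_linear SS')).
by exists (@BoundedOperator K H L (ex_intro _ M SM)).
Qed.

Lemma adjointE (T : bounded_operator H) S' (M : K) : 0 <= M ->
  adjoint_pair T S' -> (forall x, `|T x| <= M * `|x|) ->
  (adjoint dot T : H -> H) = S'.
Proof.
move=> M0 TS' TM.
have [T' T'E] := bounded_operatorE (adjoint_pairC TS')
  (adjoint_pair_bounded M0 TS' TM).
have TT' : is_adjoint dot T T' by move=> x y; rewrite T'E TS'.
have := @xgetPex _ (zero_operator H) [set S | is_adjoint dot T S]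
  (ex_intro _ _ TT').
rewrite -/(adjoint dot T) /= => adjT; apply/funext => y; apply: eq_dotr => x.
by rewrite -adjT TS'.
Qed.

(** With S' S = 1 + k v v^*, the relation S' v = v gives
S' (S' S) S = S' S + k v v^* = 1 + 2 k v v^*.  The bound on S comes from
|S x|^2 = |x|^2 + k |<x, v>|^2. *)
Lemma two_isometry_of_pair S S' v (k : K) : 0 <= k -> adjoint_pair S S' ->
  (forall x, S' (S x) = x + (k * '[x, v]) *: v) -> S' v = v ->
  exists2 T : bounded_operator H, (T : H -> H) = S & two_isometry dot T.
Proof.
move=> k0 SS' S'S S'v; pose M := 1 + k * `|v| ^+ 2.
have M1 : 1 <= M by rewrite lerDl mulr_ge0 ?exprn_ge0.
have M0 : 0 <= M := le_trans ler01 M1.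
have SM x : `|S x| <= M * `|x|.
  rewrite -ler_sqr ?nnegrE ?mulr_ge0 //.
  rewrite -[leLHS]ger0_norm ?exprn_ge0 //.
  rewrite dotP -(adjoint_pairC SS') S'S dotDl dotZl -dotP -mulrA.
  apply: (@le_trans _ _ (M * `|x| ^+ 2)).
    rewrite mulrDl mul1r; apply: le_trans (ler_normD _ _) _.
    rewrite (ger0_norm (exprn_ge0 _ _)) // lerD2l normrM (ger0_norm k0).
    rewrite -mulrA ler_wpM2l // normrM [leRHS]mulrC -exprMn expr2.
    by rewrite ler_pM ?cauchy_schwarz // mulrC cauchy_schwarz.
  (* M is at least 1, hence below its square *)
  by rewrite exprMn ler_wpM2r ?exprn_ge0 // expr2 ler_peMl.
have [T TE] := bounded_operatorE SS' SM; exists T => //; rewrite -TE in SS' SM.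
rewrite /two_isometry (adjointE M0 SS' SM) TE => x.
have S'lin := adjoint_pair_linear (adjoint_pairC SS').
rewrite !S'S.
have -> : S' (S x + (k * '[S x, v]) *: v) = S' (S x) + (k * '[S x, v]) *: v.
  by rewrite addrC S'lin S'v addrC.
rewrite -TE SS' S'v TE S'S scaler_nat mulr2n; move: (_ *: v) => q.
by rewrite -addrA opprD -[_ + (_ + q)]addrA addKr opprD -addrA addNr addr0 subrr.
Qed.

(** * Orthonormal sequences orthogonal to a finite set *)

Definition combination (X : seq H) (c : nat -> K) : H :=
  \sum_(0 <= i < size X) c i *: X`_i.

Lemma combination_cons x X c :
  combination (x :: X) c = c 0 *: x + combination X (c \o succn).
Proof. by rewrite /combination big_nat_recl. Qed.

Lemma combinationD X c d a :
  combination X (fun i => c i + a * d i) = combination X c + a *: combination X d.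
Proof.
rewrite /combination scaler_sumr -big_split; apply: eq_bigr => i _.
by rewrite scalerDl scalerA.
Qed.

Definition orthogonal_to (X : seq H) y := forall x, x \in X -> '[y, x] = 0.

Lemma dot_combination X c y : orthogonal_to X y -> '[y, combination X c] = 0.
Proof.
move=> yX; rewrite dot_sumr big_nat big1 // => i iX.
by rewrite dotZr yX ?mulr0 ?mem_nth.
Qed.

(** Gram-Schmidt without normalization: a new vector x is first replaced by its
component q orthogonal to X, which may be zero. *)
Lemma orthogonal_projection X y :
  exists c, orthogonal_to X (y - combination X c).
Proof.
elim: X y => [|x X IH] y; first by exists (fun=> 0).
have [b bX] := IH y; have [d dX] := IH x.
set r := y - _ in bX; set q := x - combination X d in dX.
pose a := if q == 0 then 0 else '[r, q] / '[q, q].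
exists (fun i => if i is j.+1 then b j - a * d j else a).
rewrite combination_cons /=.
have -> : combination X
      ((fun i => if i is j.+1 then b j - a * d j else a) \o succn) =
    combination X b - a *: combination X d.
  rewrite -scaleNr -combinationD; apply: eq_bigr => i _ /=.
  by rewrite mulNr.
have -> : y - (a *: x + (combination X b - a *: combination X d)) = r - a *: q.
  rewrite /r /q scalerBr !opprD !opprK -!addrA; congr (_ + _).
  by rewrite addrCA.
have rqX : orthogonal_to X (r - a *: q).
  by move=> z zX; rewrite dotBl dotZl bX // dX // mulr0 subrr.
move=> z; rewrite inE => /orP[/eqP ->|]; last exact: rqX.
have -> : x = q + combination X d by rewrite subrK.
rewrite dotDr (dot_combination _ rqX) addr0 dotBl dotZl /a.
have [->|qN0] := eqVneq q 0; first by rewrite !dot0r mul0r subrr.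
by rewrite divfK ?subrr // -dotP expf_neq0 // normr_eq0.
Qed.

Lemma unit_orthogonal_to X : infinite_dimensional H ->
  exists2 g, `|g| = 1 & orthogonal_to X g.
Proof.
move=> Hinf.
have [y yX] : exists y, forall c, y != combination X c.
  apply: contra_notP Hinf => noy.
  exists (size X), (fun i => X`_i) => x.
  have [c xc] : exists c, x = combination X c.
    apply: contra_notP noy => noc; exists x => c; apply/eqP => xc.
    by apply: noc; exists c.
  by exists (fun i => c i); rewrite xc /combination big_mkord.
have [c cX] := orthogonal_projection X y.
set r := y - _ in cX.
have r0 : `|r| != 0 by rewrite normr_eq0 subr_eq0.
exists (`|r|^-1 *: r).
  by rewrite normrZ ger0_norm ?invr_ge0 // mulVf.
by move=> x xX; rewrite dotZl cX // mulr0.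
Qed.

Definition orthonormal_seq (g : nat -> H) :=
  forall m n, '[g m, g n] = (m == n)%:R.

Lemma orthonormal_seq_norm g n : orthonormal_seq g -> `|g n| = 1.
Proof. by move=> og; rewrite norm_unit // og eqxx. Qed.

Lemma orthonormal_sequence X : infinite_dimensional H ->
  exists2 g, orthonormal_seq g & forall n, orthogonal_to X (g n).
Proof.
move=> Hinf.
have /choice[u uP] : forall Y : seq H, exists g, `|g| = 1 /\ orthogonal_to Y g.
  by move=> Y; have [g g1 gY] := unit_orthogonal_to Y Hinf; exists g.
(* L n lists X and the vectors chosen before step n *)
pose L := fix L n := if n is m.+1 then u (L m) :: L m else X.
have subL m k : {subset L m <= L (k + m)%N}.
  by elim: k => // k IH x xL; rewrite inE IH ?orbT.
have lt0 m n : (m < n)%N -> '[u (L n), u (L m)] = 0.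
  move=> mn; apply: (uP _).2; rewrite -(subnK mn) subL //.
  by rewrite inE eqxx.
exists (fun n => u (L n)) => [m n|n x xX]; last first.
  by apply: (uP _).2; rewrite -[n]addn0; apply: subL.
case: (ltngtP m n) => [mn|nm|->]; last exact/dot_unit/(uP _).1.
- exact/dot_eq0C/lt0.
- exact/lt0.
Qed.

End InnerProduct.

(** * The shift along an orthonormal sequence *)

Section Shift.
Variables (K : numFieldType) (theta : {rmorphism K -> K}).
Variables (H : completeNormedModType K) (dot : {dot H for theta}).
Hypothesis dotP : norm_induced_by dot.
Hypothesis Kscalars : real_or_complex theta.

Local Notation "''[' u , v ]" := (dot u v).

Lemma cvg_dotl (u : nat -> H) l y :
  u @ \oo --> l -> (fun n => '[u n, y]) @ \oo --> '[l, y].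
Proof.
move=> ul; apply/cvgrPdist_lt => e e0.
have y1 : 0 < `|y| + 1 by rewrite ltr_wpDl.
have /cvgrPdist_lt/(_ (e / (`|y| + 1)) (divr_gt0 e0 y1)) := ul.
apply: filterS => n; rewrite ltr_pdivlMr //; apply: le_lt_trans.
rewrite -dotBl; apply: le_trans (cauchy_schwarz dotP _ _) _.
by rewrite ler_wpM2l // lerDl.
Qed.

Lemma cvg_dotr (u : nat -> H) l y :
  u @ \oo --> l -> (fun n => '[y, u n]) @ \oo --> '[y, l].
Proof.
move=> ul; apply/cvgrPdist_lt => e e0.
have y1 : 0 < `|y| + 1 by rewrite ltr_wpDl.
have /cvgrPdist_lt/(_ (e / (`|y| + 1)) (divr_gt0 e0 y1)) := ul.
apply: filterS => n; rewrite ltr_pdivlMr //; apply: le_lt_trans.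
rewrite -dotBr; apply: le_trans (cauchy_schwarz dotP _ _) _.
by rewrite mulrC ler_wpM2l // lerDl.
Qed.

Lemma norm_orthonormal_sum (h : nat -> H) (a : nat -> K) m n :
  orthonormal_seq dot h ->
  `|\sum_(m <= k < n) a k *: h k| ^+ 2 = \sum_(m <= k < n) `|a k| ^+ 2.
Proof.
move=> oh; have [nm|/ltnW mn] := leqP n m; first by rewrite !big_geq // normr0 expr0n.
elim: n mn => [|n IH].
  by rewrite leqn0 => /eqP ->; rewrite !big_geq // normr0 expr0n.
rewrite leq_eqVlt => /orP[/eqP ->|]; first by rewrite !big_geq // normr0 expr0n.
rewrite ltnS => mn; rewrite !big_nat_recr //= (pythagoras dotP).
  by rewrite IH // normrZ (orthonormal_seq_norm dotP) // mulr1.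
rewrite dot_suml big_nat big1 // => k /andP[_ kn].
by rewrite dotZl dotZr oh ltn_eqF // !mulr0.
Qed.

(** x minus its projection p on the span of the g_k with k < n is orthogonal
to p. *)
Lemma bessel (g : nat -> H) x n : orthonormal_seq dot g ->
  \sum_(0 <= k < n) `|'[x, g k]| ^+ 2 <= `|x| ^+ 2.
Proof.
move=> og; rewrite -(norm_orthonormal_sum _ _ _ og); set p := \sum_(_ <= _ < _) _.
rewrite -[in leRHS](subrK p x) (pythagoras dotP) ?lerDr ?exprn_ge0 //.
rewrite {2}/p dot_sumr big_nat big1 // => k /andP[_ kn].
rewrite dotZr dotBl dot_suml (bigD1_seq k) ?mem_index_iota ?iota_uniq //=.
rewrite dotZl og eqxx mulr1 big1 ?addr0 ?subrr ?mulr0 // => i ik.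
by rewrite dotZl og (negPf ik) mulr0.
Qed.

Lemma fourier_coef_cauchy (g : nat -> H) x : orthonormal_seq dot g ->
  cauchy (series (fun k => `|'[x, g k]| ^+ 2) @ \oo).
Proof.
move=> og; apply: (nonneg_series_cauchy Kscalars) => n; first exact: exprn_ge0.
exact: bessel.
Qed.

Lemma cvg_fourier_coef0 (g : nat -> H) x : orthonormal_seq dot g ->
  (fun n => '[x, g n]) @ \oo --> 0.
Proof.
move=> og; apply/cvgr0Pnorm_lt => e e0.
have /cauchy_seriesP/(_ _ (exprn_gt0 2 e0)) := fourier_coef_cauchy x og.
case=> -[P Q] /= [[p _ pP] [q _ qQ]] PQ.
exists (maxn p q) => // n /=; rewrite geq_max => /andP[pn qn].
have := PQ (n, n.+1) (conj (pP n pn) (qQ n.+1 (leqW qn))).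
by rewrite /= big_nat1 ger0_norm ?exprn_ge0 // ltr_sqr ?nnegrE // ltW.
Qed.

Lemma cvg_fourier (g h : nat -> H) x :
  orthonormal_seq dot g -> orthonormal_seq dot h ->
  cvgn (series (fun k => '[x, g k] *: h k)).
Proof.
move=> og oh; apply: cauchy_cvg; apply/cauchy_seriesP => e e0.
have /cauchy_seriesP/(_ _ (exprn_gt0 2 e0)) := fourier_coef_cauchy x og.
apply: filterS => n.
rewrite -(norm_orthonormal_sum _ _ _ oh) ger0_norm ?exprn_ge0 //.
by rewrite ltr_sqr ?nnegrE // ltW.
Qed.

Lemma seq_cvg_unique (V : pseudoMetricNormedZmodType K) (u : nat -> V) (l l' : V) :
  u @ \oo --> l -> u @ \oo --> l' -> l = l'.
Proof. exact/cvg_unique/norm_hausdorff. Qed.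

Section ShiftOperator.
Variable g : nat -> H.
Hypothesis og : orthonormal_seq dot g.

Let shift_sum x n := x + \sum_(0 <= k < n) '[x, g k] *: (g k.+1 - g k).
Let backshift_sum y n := y + \sum_(0 <= k < n) '[y, g k.+1 - g k] *: g k.

(** The limits of these sums are the isometry sending g_n to g_(n+1) and fixing
the vectors orthogonal to all g_n, and its adjoint. *)
Definition unilateral_shift x := limn (shift_sum x).
Definition backward_shift y := limn (backshift_sum y).

Let og1 : orthonormal_seq dot (g \o succn).
Proof. by move=> m n /=; rewrite og. Qed.

Lemma cvg_shift x : shift_sum x @ \oo --> unilateral_shift x.
Proof.
apply: is_cvgD; first exact: is_cvg_cst.
rewrite (_ : (fun n => _) = fun n => series (fun k => '[x, g k] *: g k.+1) n -
  series (fun k => '[x, g k] *: g k) n).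
  by apply: is_cvgB; [exact: (@cvg_fourier g (g \o succn)) | exact: cvg_fourier].
apply/funext => n /=; rewrite /series/= -sumrB.
by apply: eq_bigr => k _; rewrite scalerBr.
Qed.

Lemma cvg_backshift y : backshift_sum y @ \oo --> backward_shift y.
Proof.
apply: is_cvgD; first exact: is_cvg_cst.
rewrite (_ : (fun n => _) = fun n => series (fun k => '[y, g k.+1] *: g k) n -
  series (fun k => '[y, g k] *: g k) n).
  by apply: is_cvgB; [exact: (@cvg_fourier (g \o succn) g) | exact: cvg_fourier].
apply/funext => n /=; rewrite /series/= -sumrB.
by apply: eq_bigr => k _; rewrite dotBr scalerBl.
Qed.

Lemma unilateral_shift_adjoint : adjoint_pair dot unilateral_shift backward_shift.
Proof.
move=> x y; apply: (seq_cvg_unique (@cvg_dotl _ _ y (@cvg_shift x))).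
rewrite (_ : (fun n => _) = fun n => '[x, backshift_sum y n]).
  exact: cvg_dotr (@cvg_backshift y).
apply/funext => n; rewrite dotDl dotDr dot_suml dot_sumr; congr (_ + _).
by apply: eq_bigr => k _; rewrite dotZl dotZr -dotC mulrC.
Qed.

Lemma unilateral_shift_id x : (forall n, '[x, g n] = 0) -> unilateral_shift x = x.
Proof.
move=> xg; apply: (seq_cvg_unique (@cvg_shift x)).
rewrite (_ : shift_sum x = fun=> x); first exact: cvg_cst.
apply/funext => n; rewrite /shift_sum big1 ?addr0 // => k _.
by rewrite xg scale0r.
Qed.

Let dot_shift_sum x m n : '[shift_sum x n, g m] =
  '[x, g m] + \sum_(0 <= k < n) '[x, g k] * ((k.+1 == m)%:R - (k == m)%:R).
Proof.
rewrite dotDl dot_suml; congr (_ + _).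
by apply: eq_bigr => k _; rewrite dotZl dotBl !og.
Qed.

Lemma dot_unilateral_shift x m :
  '[unilateral_shift x, g m] = if m is k.+1 then '[x, g k] else 0.
Proof.
apply: (seq_cvg_unique (@cvg_dotl _ _ (g m) (@cvg_shift x))).
apply: cvg_near_cst; exists m.+1 => // n /= mn; apply/eqP.
rewrite dot_shift_sum; under eq_bigr do rewrite mulrBr; rewrite sumrB.
rewrite addrCA [X in - X](bigD1_seq m) ?mem_index_iota ?iota_uniq //= eqxx mulr1.
rewrite [X in - (_ + X)]big1 => [|i /negPf ->]; last by rewrite mulr0.
rewrite addr0 subrr addr0.
case: m mn => [_|m mn]; first by rewrite big1 // => k _; rewrite mulr0.
rewrite (bigD1_seq m) ?mem_index_iota ?iota_uniq ?(ltnW mn) //= eqxx mulr1.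
by rewrite big1 ?addr0 // => i /negPf im; rewrite eqSS im mulr0.
Qed.

(** The coefficients of the shift of x are those of x moved one step, so the
partial sums of the two series telescope up to one term, which tends to 0. *)
Lemma unilateral_shiftK : cancel unilateral_shift backward_shift.
Proof.
move=> x; apply: (seq_cvg_unique (@cvg_backshift (unilateral_shift x))).
have telescope n : backshift_sum (unilateral_shift x) n =
    (unilateral_shift x - shift_sum x n) + (x + '[unilateral_shift x, g n] *: g n).
  rewrite /backshift_sum -addrA; congr (_ + _).
  rewrite /shift_sum opprD addrACA addNr add0r.
  apply: (addrI (\sum_(0 <= k < n) '[x, g k] *: (g k.+1 - g k))).
  rewrite addNKr -big_split /=.
  elim: n => [|n IH]; first by rewrite big_geq // dot_unilateral_shift scale0r.
  rewrite big_nat_recr //= IH dotBr !dot_unilateral_shift scalerBr scalerBl.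
  by rewrite subrKA subrKC.
rewrite (funext telescope) -[X in _ --> X]add0r; apply: cvgD.
  rewrite -[X in _ --> X](subrr (unilateral_shift x)).
  by apply: cvgB; [exact: cvg_cst | exact: cvg_shift].
rewrite -[X in _ --> X]addr0; apply: cvgD; first exact: cvg_cst.
apply/cvgr0Pnorm_lt => e e0.
have /cvgr0Pnorm_lt/(_ e e0) := cvg_fourier_coef0 (unilateral_shift x) og.
apply: filterS => n; rewrite normrZ.
by rewrite (orthonormal_seq_norm dotP) // mulr1.
Qed.

End ShiftOperator.
End Shift.

(** * Two-isometries close to a rank-one perturbation of the identity *)

Section Approximation.
Variables (K : numFieldType) (theta : {rmorphism K -> K}).
Variables (H : completeNormedModType K) (dot : {dot H for theta}).
Hypothesis dotP : norm_induced_by dot.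
Hypothesis Kscalars : real_or_complex theta.

Local Notation "''[' u , v ]" := (dot u v).

Lemma reflection_adjoint (a : K) h : theta a = a ->
  adjoint_pair dot (fun y => y - (a * '[y, h]) *: h)
    (fun y => y - (a * '[y, h]) *: h).
Proof.
move=> ta x y; rewrite dotBl dotBr dotZl dotZr rmorphM ta -dotC.
by rewrite mulrAC.
Qed.

Lemma reflectionK (a : K) h : a * '[h, h] = 2 ->
  involutive (fun y => y - (a * '[y, h]) *: h).
Proof.
move=> ah y; rewrite dotBl dotZl.
have -> : a * ('[y, h] - a * '[y, h] * '[h, h]) = a * '[y, h] * (1 - a * '[h, h]).
  by ring.
have -> : 1 - a * '[h, h] = - 1 by rewrite ah; ring.
by rewrite mulrN1 scaleNr opprK subrK.
Qed.

(** A rational parametrization of the circle dispenses with square roots, which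
a numeric field need not have. *)
Lemma small_circle_point (eps : K) : 0 < eps ->
  exists al be : K, [/\ 0 < al, al <= eps, 0 <= be & al ^+ 2 + be ^+ 2 = 1].
Proof.
move=> e0; pose t := eps / (2 + eps).
have e2 : 0 < 2 + eps by rewrite addr_gt0.
have t0 : 0 < t by rewrite divr_gt0.
have t1 : t <= 1 by rewrite ler_pdivrMr // mul1r lerDr.
have t2 : 2 * t <= eps.
  rewrite mulrA ler_pdivrMr // mulrC ler_pM2l // lerDl; exact: ltW.
have N1 : 1 <= 1 + t ^+ 2 by rewrite lerDl exprn_ge0 // ltW.
have N0 : 0 < 1 + t ^+ 2 := lt_le_trans ltr01 N1.
exists (2 * t / (1 + t ^+ 2)), ((1 - t ^+ 2) / (1 + t ^+ 2)); split.
- by rewrite divr_gt0 // mulr_gt0.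
- apply: le_trans t2; rewrite ler_pdivrMr // ler_peMr // mulr_ge0 //; exact: ltW.
- by rewrite divr_ge0 ?(ltW N0) // subr_ge0 expr_le1 // ltW.
- by field; rewrite gt_eqF.
Qed.

(** T x = R (U x + s <x, v> g_0), with adjoint y |-> U^* R y + s <R y, g_0> v.
As alpha is small, v is close to the vector f, which is orthogonal to X; this is
why the large factor s has only a moderate effect on X. *)
Lemma two_isometry_approximation e (X : seq H) (eps : K) :
  infinite_dimensional H -> `|e| = 1 -> 0 < eps ->
  exists2 T : bounded_operator H, two_isometry dot T &
    forall x, x \in X ->
      `|T x - (x + (2 / 3 * '[x, e]) *: e)| <= `|'[x, e]| * eps.
Proof.
move=> Hinf e1 eps0.
have [al [be [al0 ale be0 alg]]] := small_circle_point eps0.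
have [tal tbe] : theta al = al /\ theta be = be.
  by split; apply: (theta_ge0 dotP e1) => //; exact: ltW.
have [g og gX] := orthonormal_sequence dotP (e :: X) Hinf.
have {}gX n x : x \in e :: X -> '[x, g n] = 0 by move=> xX; exact/dot_eq0C/gX.
pose G := g \o succn.
have oG : orthonormal_seq dot G by move=> m n; rewrite /G/= og.
pose U := unilateral_shift dot G; pose U' := backward_shift dot G.
have UU' : adjoint_pair dot U U' by exact: unilateral_shift_adjoint.
have UK : cancel U U' by exact: unilateral_shiftK.
have Ufix x : (forall n, '[x, G n] = 0) -> U x = x by exact: unilateral_shift_id.
have UG x : '[U x, G 0] = 0 by rewrite dot_unilateral_shift.
pose f := g 0; pose g0 := G 0.
pose v := al *: e + be *: f; pose w := be *: e - al *: f; pose h := w - 2 *: g0.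
have ee : '[e, e] = 1 by exact: dot_unit.
have ff : '[f, f] = 1 by rewrite og.
have gg : '[g0, g0] = 1 by rewrite og.
have ef : '[e, f] = 0 by rewrite gX // mem_head.
have fe : '[f, e] = 0 by exact: dot_eq0C.
have eg : '[e, g0] = 0 by rewrite gX // mem_head.
have ge : '[g0, e] = 0 by exact: dot_eq0C.
have fg : '[f, g0] = 0 by rewrite og.
have gf : '[g0, f] = 0 by exact: dot_eq0C.
have t2 : theta 2 = 2 by exact: rmorph_nat.
pose E := (dotE, ee, ff, gg, ef, fe, eg, ge, fg, gf, tal, tbe, t2).
have vv : '[v, v] = 1 by rewrite -[RHS]alg /v !E; ring.
have hh : '[h, h] = 5.
  transitivity (al ^+ 2 + be ^+ 2 + 4); last by rewrite alg; ring.
  by rewrite /h /w !E; ring.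
have vh : '[v, h] = 0 by rewrite /v /h /w !E; ring.
have vg : '[v, g0] = 0 by rewrite /v !E; ring.
(* this s makes the g0 component of S x vanish for x in X *)
pose s := 4 / 3 * be / al.
have s0 : 0 <= s by rewrite divr_ge0 ?(ltW al0) // mulr_ge0 // divr_ge0.
(* the reflection along h sends w to (3/5) w + (4/5) g0 *)
pose R y := y - (2 / 5 * '[y, h]) *: h.
have RK : involutive R by apply: reflectionK; rewrite hh; field.
have RR : adjoint_pair dot R R.
  by apply: reflection_adjoint; rewrite fmorph_div /= !rmorph_nat.
have Rv : R v = v by rewrite /R vh mulr0 scale0r subr0.
have ts : theta s = s.
  by rewrite /s !(fmorph_div, rmorphM) /= tal tbe !rmorph_nat.
have Uv : U v = v.
  apply: Ufix => n; rewrite /v !dotE gX ?mem_head // og.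
  by rewrite !mulr0 addr0.
have U'v : U' v = v by rewrite -{1}Uv UK.
have U'g : U' g0 = 0.
  by apply: (eq_dotr dotP) => z; rewrite -UU' UG dot0r.
pose S x := R (U x + (s * '[x, v]) *: g0).
pose S' y := U' (R y) + (s * '[R y, g0]) *: v.
have U'lin := adjoint_pair_linear dotP (adjoint_pairC UU').
have SS' : adjoint_pair dot S S'.
  move=> x y; rewrite /S RR (dotDl _ (U x)) (dotZl _ _ g0) UU'.
  rewrite [RHS](dotDr _ x (U' (R y))) (dotZr _ _ x v) rmorphM /= ts -dotC.
  by rewrite mulrAC.
have S'S x : S' (S x) = x + (s ^+ 2 * '[x, v]) *: v.
  rewrite /S' /S RK addrC [U x + _]addrC U'lin UK U'g scaler0 add0r.
  by rewrite dotDl dotZl UG gg addr0 mulr1 addrC mulrA.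
have S'v : S' v = v by rewrite /S' Rv U'v vg mulr0 scale0r addr0.
have [T TE Tiso] := two_isometry_of_pair dotP (exprn_ge0 2 s0) SS' S'S S'v.
exists T => // x xX; rewrite TE.
have xeX : x \in e :: X by rewrite inE xX orbT.
pose c := '[x, e].
have xf : '[x, f] = 0 by exact: gX.
have xg : '[x, g0] = 0 by exact: gX.
have Ux : U x = x by apply: Ufix => n; exact: gX.
have xv : '[x, v] = al * c by rewrite /v !dotE xf tal tbe mulr0 addr0.
have sE : s * '[x, v] = 4 / 3 * be * c.
  by rewrite xv /s; field; rewrite gt_eqF.
have xh : '[x + (4 / 3 * be * c) *: g0, h] = - (5 / 3 * be * c).
  by rewrite /h /w !E xf xg -/c; field.
have -> : S x - (x + (2 / 3 * c) *: e) = - (2 / 3 * al * c) *: v.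
  rewrite /S Ux sE /R xh; pose b := 2 / 3 * be * c.
  have -> : 2 / 5 * - (5 / 3 * be * c) = - b by rewrite /b; field.
  have -> : 4 / 3 * be * c = b * 2 by rewrite /b; field.
  rewrite scaleNr opprK /h scalerBr scalerA addrA addrAC addrK.
  rewrite opprD addrACA subrr add0r /w /v scalerBr scalerDr !scalerA.
  rewrite addrAC -scalerBl -(scaleNr (b * al)).
  congr (_ *: _ + _ *: _); last by rewrite /b; ring.
  have -> : 2 / 3 * c = 2 / 3 * c * (al ^+ 2 + be ^+ 2) by rewrite alg mulr1.
  by rewrite /b; ring.
have v1 : `|v| = 1 by exact: norm_unit.
rewrite normrZ v1 mulr1 normrN normrM mulrC ler_wpM2l //.
have a0 : 0 <= 2 / 3 * al by rewrite mulr_ge0 ?divr_ge0 // ltW.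
rewrite (ger0_norm a0); apply: le_trans ale.
by rewrite ler_piMl ?(ltW al0) // ler_pdivrMr // mul1r ler_nat.
Qed.

(** At e the defect of A is (1 - (5/3)^2)^2 = 256/81. *)
Lemma rank_one_perturbation e : `|e| = 1 ->
  exists2 A : bounded_operator H, ~ two_isometry dot A &
    forall x, A x = x + (2 / 3 * '[x, e]) *: e.
Proof.
move=> e1; have ee : '[e, e] = 1 by exact: dot_unit.
pose S x := x + (2 / 3 * '[x, e]) *: e.
have SS : adjoint_pair dot S S.
  move=> x y; rewrite /S dotDl dotDr dotZl dotZr rmorphM -dotC.
  by rewrite fmorph_div /= !rmorph_nat mulrAC.
have c0 : 0 <= 2 / 3 :> K by rewrite divr_ge0.
have SM x : `|S x| <= (1 + 2 / 3) * `|x|.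
  rewrite (mulrDl 1) mul1r; apply: le_trans (ler_normD _ _) _; rewrite lerD2l.
  rewrite normrZ e1 mulr1 normrM (ger0_norm c0) ler_wpM2l //.
  by have := cauchy_schwarz dotP x e; rewrite e1 mulr1.
have [A AE] := bounded_operatorE dotP SS SM.
exists A => [|x]; last by rewrite AE.
have Se a : S (a *: e) = (a * (5 / 3)) *: e.
  rewrite /S dotZl ee mulr1 -scalerDl; congr (_ *: _); by field.
rewrite -AE in SS SM; move=> /(_ e).
rewrite (adjointE dotP (addr_ge0 ler01 c0) SS SM) AE.
rewrite -[e]scale1r !Se scalerA -scalerBl -scalerDl => /eqP.
rewrite scaler_eq0 -[e == 0]normr_eq0 e1 oner_eq0 orbF.
suff -> : 1 - 2 * (1 * (5 / 3) * (5 / 3)) +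
    1 * (5 / 3) * (5 / 3) * (5 / 3) * (5 / 3) = 256%:R / 81%:R :> K.
  by rewrite mulf_eq0 invr_eq0 !pnatr_eq0.
by field.
Qed.

(** Testing on finite sets X with tolerance 1 is enough, because X may contain
large multiples of a given vector.  The sets of T in C that pass the test on X
generate a filter converging to A. *)
Lemma closure_SOT (C : set (SOT H)) (A : bounded_operator H) :
  (forall X : seq H, exists2 T : bounded_operator H, C T &
     forall x, x \in X -> `|T x - A x| < 1) ->
  closure C (A : SOT H).
Proof.
move=> approx.
pose N (X : seq H) : set (SOT H) :=
  [set T | C T /\ forall x, x \in X -> `|(T : bounded_operator H) x - A x| < 1].
pose F := filter_from [set: seq H] N.
have FF : ProperFilter F.
  apply: filter_from_proper; last by move=> X _; have [T CT TA] := approx X; exists T.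
  apply: filter_fromT_filter; first by exists [::].
  move=> X Y; exists (X ++ Y) => T [CT TA]; split; split => // x xX;
    by apply: TA; rewrite mem_cat xX ?orbT.
have FA : F --> (A : SOT H).
  apply/cvg_SOT => x; apply/cvgrPdistC_lt => eps e0.
  exists [:: eps^-1 *: x] => // T [_ /(_ _ (mem_head _ _))].
  rewrite 2!linearZ_LR -scalerBr normrZ gtr0_norm ?invr_gt0 //.
  by rewrite mulrC ltr_pdivrMr // mul1r.
move=> B /FA FB.
have FC : F C by exists [::] => // T [].
have /(@filter_ex _ _ FF)[T] : F (C `&` B) by exact: filterI.
by exists T.
Qed.

End Approximation.

Theorem corollary2 (K : numFieldType) (theta : {rmorphism K -> K})
    (Kscalars : real_or_complex theta)
    (H : completeNormedModType K) (dot : {dot H for theta})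
    (dotP : norm_induced_by dot) (Hinf : infinite_dimensional H) :
  ~ closed ([set T | two_isometry dot T] : set (SOT H)).
Proof.
move=> closed_iso.
have [e e1 _] := unit_orthogonal_to dotP [::] Hinf.
have [A Anot AE] := rank_one_perturbation dotP e1.
apply: Anot; apply: closed_iso; apply: closure_SOT => X.
pose M := 1 + \sum_(x <- X) `|dot x e|.
have M0 : 0 < M by rewrite ltr_pwDl // sumr_ge0.
have [T Tiso TX] :=
  two_isometry_approximation dotP Kscalars X Hinf e1 (divr_gt0 ltr01 M0).
exists T => // x xX; rewrite AE; apply: le_lt_trans (TX x xX) _.
rewrite mul1r ltr_pdivrMr // mul1r ltr_pwDl //.
rewrite (big_rem x xX) /= lerDl sumr_ge0 //.
Qed.
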